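(* Given $n_1,\ldots,n_k\ge2$ with $n_i\mid n_{i-1}$ for $2\le i\le k$, there exist abelian groups $G_+$ and $G_-$ with at most two generators and renewal systems $\mathsf{X}(L_+)$ and $\mathsf{X}(L_-)$ of finite type such that $$\mathrm{BF}_+(\mathsf{X}(L_\pm))=\pm\,G_\pm\oplus\mathbb{Z}/n_1\mathbb{Z}\oplus\cdots\oplus\mathbb{Z}/n_k\mathbb{Z}.$$
   Context: For a finite list $L$ of nonempty words over a finite alphabet, the renewal system $\mathsf{X}(L)$ is the shift space whose language is the set of factors of finite concatenations of words from $L$. Every shift of finite type is conjugate to the edge shift of a finite directed graph with some $n\times n$ adjacency matrix $A$; its Bowen-Franks group is $\mathbb{Z}^n/\mathbb{Z}^n(\mathrm{Id}-A)$ and its determinant is $\det(\mathrm{Id}-A)$, both independent of the choice of $A$. The signed Bowen-Franks group $\mathrm{BF}_+$ is the Bowen-Franks group together with the sign of the determinant: $\mathrm{BF}_+=+G$ means that the Bowen-Franks group is (isomorphic to) $G$ and the determinant is positive, and $\mathrm{BF}_+=-G$ that the Bowen-Franks group is $G$ and the determinant is negative (the sign applies to the whole direct sum). *)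

(* Defs.v *)
From HB Require Import structures.
From mathcomp Require Import all_boot all_order all_algebra.
From mathcomp Require Import boolp classical_sets.

Set Implicit Arguments.
Unset Strict Implicit.
Unset Printing Implicit Defensive.

Import Order.TTheory GRing.Theory Num.Theory.

Local Open Scope classical_set_scope.
Local Open Scope ring_scope.

Section ShiftSpaces.
Variable A : finType.

(* The factor x_[i, i + m) of a bi-infinite sequence. *)
Definition factor (x : int -> A) (i : int) (m : nat) : seq A :=
  [seq x (i + k%:Z) | k <- iota 0 m].

Definition avoiding (F : set (seq A)) : set (int -> A) :=
  [set x | forall i m, ~ F (factor x i m)].

Definition shift_space (X : set (int -> A)) : Prop :=
  exists F : set (seq A), X = avoiding F.

Definition finite_type (X : set (int -> A)) : Prop :=
  exists F : seq (seq A), X = avoiding [set` F].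

Definition language (X : set (int -> A)) : set (seq A) :=
  [set w | exists2 x, X x & exists i, w = factor x i (size w)].

Definition concat_factors (L : seq (seq A)) : set (seq A) :=
  [set w | exists2 s : seq (seq A), {subset s <= L} & infix w (flatten s)].

(* A shift space is the set of points all of whose factors lie in its language;
   see [language_renewal] and [renewal_unique]. *)
Definition renewal (L : seq (seq A)) : set (int -> A) :=
  avoiding (~` concat_factors L).

Lemma size_factor x i m : size (factor x i m) = m.
Proof. by rewrite size_map size_iota. Qed.

Lemma shift_spaceE X : shift_space X -> X = avoiding (~` language X).
Proof.
case=> F ->; apply/seteqP; split=> x /= Xx i m.
  by apply; exists x => //; exists i; rewrite size_factor.
move/contrapT: (Xx i m) => [y Yy [j ->]].
exact: Yy.
Qed.

Lemma renewal_unique X L :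
  shift_space X -> language X = concat_factors L -> X = renewal L.
Proof. by move=> /shift_spaceE XE LE; rewrite XE LE. Qed.

Lemma language_renewal L : L != [::] -> [::] \notin L ->
  language (renewal L) = concat_factors L.
Proof.
move=> L0 Lne; apply/seteqP; split=> w /=.
  by case=> x Lx [i ->]; apply: contrapT; apply: Lx.
case=> s sL ws; pose s' := s ++ L; pose u := flatten s'.
have s'L : {subset s' <= L} by move=> v; rewrite mem_cat => /orP[/sL|].
have /infixP[p [q uE]] : infix w u.
  by rewrite /u flatten_cat; apply: infix_catr.
have u_gt0 : (0 < size u)%N.
  rewrite lt0n size_eq0; apply: contraNneq Lne.
  case: L L0 @s' @u {sL s'L uE} => // v L _ /=.
  rewrite flatten_cat /=; case: (flatten s) => //= vL.
  by case: v vL => // _; rewrite inE eqxx.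
have [a _] : exists a : A, true by case: (u) u_gt0 => // a; exists a.
pose x (i : int) : A := nth a u `|(i %% (size u)%:Z)%Z|%N.
have xE (j : nat) : x j%:Z = nth a u (j %% size u).
  by rewrite /x modz_nat absz_nat.
exists x; last first.
  exists (size p)%:Z; apply: (@eq_from_nth _ a); first by rewrite size_factor.
  move=> k kw; rewrite (nth_map 0%N) ?size_iota // nth_iota // add0n -PoszD xE.
  have lt : (size p + k < size u)%N.
    by rewrite uE !size_cat ltn_add2l (leq_trans kw) // leq_addr.
  rewrite modn_small // uE nth_cat ltnNge leq_addr /=.
  by rewrite addKn nth_cat kw.
move=> i m; apply; pose r := `|(i %% (size u)%:Z)%Z|%N.
have u0 : (size u)%:Z != 0 by rewrite eqz_nat -lt0n.
have rE : (i %% (size u)%:Z)%Z = r%:Z by rewrite gez0_abs // modz_ge0.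
have r_lt : (r < size u)%N by rewrite -ltz_nat -rE ltz_pmod // ltz_nat.
pose U N := flatten (nseq N u).
have US N : size (U N) = (N * size u)%N.
  by elim: N => // N IH; rewrite /U /= size_cat -/(U N) IH mulSn.
have UE N j : (j < N * size u)%N -> nth a (U N) j = nth a u (j %% size u).
  elim: N j => // N IH j; rewrite mulSn => jN; rewrite /U /= nth_cat.
  case: ltnP => ju; first by rewrite modn_small.
  by rewrite IH ?ltn_subLR // -[in RHS](subnK ju) modnDr.
have rm : (r + m <= m.+1 * size u)%N.
  by rewrite mulSn leq_add ?(ltnW r_lt) // leq_pmulr.
have -> : factor x i m = take m (drop r (U m.+1)).
  have sz : size (take m (drop r (U m.+1))) = m.
    by rewrite size_takel // size_drop US leq_subRL // (leq_trans _ rm) ?leq_addr.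
  apply: (@eq_from_nth _ a); first by rewrite sz size_factor.
  move=> k; rewrite size_factor => km.
  rewrite (nth_map 0%N) ?size_iota // nth_iota // add0n nth_take // nth_drop.
  rewrite UE; last by apply: leq_trans rm; rewrite ltn_add2l.
  by rewrite /x -modzDml rE -PoszD modz_nat absz_nat.
exists (flatten (nseq m.+1 s')).
  by move=> v /flattenP[t /nseqP[-> _]]; apply: s'L.
have -> : flatten (flatten (nseq m.+1 s')) = U m.+1.
  rewrite /U; elim: m.+1 => //= N IH.
  by rewrite flatten_cat IH.
apply: (@infix_trans _ (drop r (U m.+1))).
  exact: infix_take.
exact: infix_drop.
Qed.

End ShiftSpaces.

Section Conjugacy.
Variables A B : finType.

Definition sliding_block_code (X : set (int -> A)) (Y : set (int -> B))
    (f : (int -> A) -> (int -> B)) : Prop :=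
  (forall x, X x -> Y (f x)) /\
  exists (m a : nat) (Phi : seq A -> B),
    forall x, X x -> forall i, f x i = Phi (factor x (i - m%:Z) (m + a).+1).

End Conjugacy.

Definition conjugate (A B : finType) (X : set (int -> A)) (Y : set (int -> B))
  : Prop :=
  exists f g, [/\ sliding_block_code X Y f, sliding_block_code Y X g,
    forall x, X x -> g (f x) = x & forall y, Y y -> f (g y) = y].

Section Graphs.

(* A finite directed multigraph with vertex set 'I_n. *)
Record digraph (n : nat) := Digraph {
  edge : finType;
  source : edge -> 'I_n;
  target : edge -> 'I_n }.

Variables (n : nat) (G : digraph n).

Definition adjacency : 'M[int]_n :=
  \matrix_(i, j) (#|[pred e : edge G | (source e == i) && (target e == j)]|)%:Z.

Definition edge_shift : set (int -> edge G) :=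
  [set x | forall i, target (x i) = source (x (i + 1))].

End Graphs.

Arguments edge_shift {n} G _.

Section BowenFranks.
Variables (n : nat) (A : 'M[int]_n).

Definition BF_rel : pred 'rV[int]_n :=
  fun u => `[< exists v : 'rV[int]_n, u = v *m (1%:M - A) >].

Lemma BF_rel_closed : zmod_closed BF_rel.
Proof.
split; first by apply/asboolP; exists 0; rewrite mul0mx.
move=> _ _ /asboolP[u ->] /asboolP[v ->]; apply/asboolP.
by exists (u - v); rewrite mulmxBl.
Qed.

HB.instance Definition _ :=
  GRing.isZmodClosed.Build 'rV[int]_n BF_rel BF_rel_closed.

Definition BF : zmodType :=
  Quotient.quot (GRing.ZmodClosed.clone 'rV[int]_n BF_rel _).

End BowenFranks.

Definition zmod_iso (G H : zmodType) : Prop :=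
  exists f : {additive G -> H}, bijective f.

(* The sign of the determinant is [e]; the graph is arbitrary because BF and
   the determinant are conjugacy invariants of the edge shift. *)
Definition signed_BF (A : finType) (X : set (int -> A)) (e : int)
    (H : zmodType) : Prop :=
  exists n (G : digraph n),
    [/\ conjugate X (edge_shift G), zmod_iso (BF (adjacency G)) H
      & Num.sg (\det (1%:M - adjacency G)) = e].

Definition at_most_two_generators (G : zmodType) : Prop :=
  exists x y : G, forall z : G, exists a b : int, z = x *~ a + y *~ b.

(* G (+) Z/n_1 (+) ... (+) Z/n_k; only meaningful when all the n_i are at
   least 2, since ['Z_0] and ['Z_1] both denote Z/2. *)
Definition plus_cyclics (G : zmodType) (n : seq nat) : zmodType :=
  foldl (fun (H : zmodType) m => (H * 'Z_m)%type : zmodType) G n.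

(* Main.v *)
Require Import Defs.
From HB Require Import structures.
From mathcomp Require Import all_boot all_order all_algebra.
From mathcomp Require Import boolp classical_sets.
From mathcomp Require Import ring zify.

(** The alphabet consists of letters [k_1, ..., k_r], which cannot stand alone,
    and of autonomous letters [y]. Some pairs [k y] and [y k] are linked, and the
    only constraint on a sequence is that every [k] be linked to its left or to
    its right neighbour. This is a condition on factors of length 3, and every
    word satisfying it splits into such words of length at most 3, so the shift
    is a renewal system of finite type.

    Let [C i j] be the number of [y] with both [k_i y] and [y k_j] linked, and
    let [m] letters [y] be free of links. If in addition each [k_i] has exactly
    two letters linked to it only on its right and two only on its left, unimodular
    operations reduce [Id - A], for [A] the matrix of the automaton which
    remembers the pending link, to the diagonal blocks [-(4 r + m - 1)], [Id] and
    [Id + C]. Here [m = 3], and [Id + C] is a unimodular block followed by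
    [diag (n_1, ..., n_k)]: the determinant of the former prescribes the sign. *)

Set Implicit Arguments.
Unset Strict Implicit.
Unset Printing Implicit Defensive.

Import Order.TTheory GRing.Theory Num.Theory.

Local Open Scope ring_scope.

Lemma factorS (A : finType) (x : int -> A) i m :
  factor x i m.+1 = x i :: factor x (i + 1) m.
Proof.
rewrite /factor [iota 0 _]/= (iotaDl 1 0 m) /= addr0 -map_comp.
by congr (_ :: _); apply: eq_map => k /=; rewrite -addrA.
Qed.

(** * Linked words and the renewal system they generate *)

Section Words.
Variables (I Y : finType) (pre post : Y -> option I).

Notation letter := (I + Y)%type.

Definition link (a b : letter) : bool :=
  match a, b with
  | inl k, inr y => pre y == Some k
  | inr y, inl k => post y == Some k
  | _, _ => false
  end.

Definition autonomous (a : letter) : bool := if a is inr _ then true else false.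

Definition supported (a x b : letter) : bool :=
  [|| autonomous x, link a x | link x b].

Definition link_head (a : letter) (w : seq letter) : bool :=
  if w is b :: _ then link a b else false.

(* [l] tells whether the first letter of the word is linked to a letter
   standing on its left. *)
Fixpoint valid (l : bool) (w : seq letter) : bool :=
  if w is a :: w' then
    [|| autonomous a, l | link_head a w'] && valid (link_head a w') w'
  else true.

Lemma valid_cons2 l a b w : valid l [:: a, b & w] =
  [|| autonomous a, l | link a b] && valid (link a b) (b :: w).
Proof. by []. Qed.

Lemma valid_weaken (l l' : bool) w : (l -> l') -> valid l w -> valid l' w.
Proof.
case: w => [//|a w] ll' /= /andP[+ ->]; rewrite andbT.
by case/or3P=> [->|/ll' ->|->]; rewrite ?orbT.
Qed.

(** Juxtaposition can create links but never destroys one. *)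
Lemma valid_cat l u v : valid l u -> valid false v -> valid l (u ++ v).
Proof.
elim: u l => [|a u IH] l /=; first by move=> _; apply: valid_weaken.
case/andP=> ha hu hv; case: u IH ha hu => [|b u] IH ha hu /=.
  rewrite (valid_weaken _ hv) // andbT.
  by case/or3P: ha => [->|->|//]; rewrite ?orbT.
by rewrite ha; apply: IH.
Qed.

Lemma valid_flatten s : all (valid false) s -> valid false (flatten s).
Proof. by elim: s => //= w s IH /andP[hw /IH]; apply: valid_cat. Qed.

Lemma valid_drop l w i : valid l w -> exists l', valid l' (drop i w).
Proof.
elim: i l w => [|i IH] l [|a w]; rewrite ?drop0 /=; try by exists l.
by case/andP=> _; apply: IH.
Qed.

Lemma valid_supported l w a x b :
  valid l w -> infix [:: a; x; b] w -> supported a x b.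
Proof.
move=> hw /infixP[p [q def_w]]; have [l' ] := valid_drop (size p) hw.
by rewrite def_w drop_size_cat //= => /and3P[_].
Qed.

(** A head that depends on its left neighbour is not linked on its right, so the tail borrows
    nothing from it. *)
Lemma validF_behead l a w :
  valid l (a :: w) -> ~~ valid false (a :: w) -> l /\ valid false w.
Proof.
rewrite /=; case: (autonomous a) => /=; first by move=> ->.
case: (link_head a w); rewrite ?orbT ?orbF /=; first by move=> ->.
by case/andP.
Qed.

(** Cut after the first autonomous letter [y], which has at most one letter [k] before it. If the
    rest is not valid alone, [validF_behead] says that its head needs [y] and that what follows this
    head is valid: cut one letter later. *)
Lemma valid_parse w : valid false w ->
  exists2 s, all (fun u => valid false u && (0 < size u <= 3)%N) s
           & w = flatten s.
Proof.
move: {2}(size w) (leqnn (size w)) => n.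
elim: n w => [|n IH] w; first by rewrite leqn0 => /nilP->; exists [::].
have IHcat u v : valid false u -> (0 < size u <= 3)%N -> valid false v ->
    (size (u ++ v) <= n.+1)%N ->
    exists2 s, all (fun u => valid false u && (0 < size u <= 3)%N) s
             & u ++ v = flatten s.
  move=> hu su hv; rewrite size_cat => sn.
  have [|s hs ->] := IH v _ hv; first by case/andP: su; lia.
  by exists (u :: s) => //=; rewrite hu su.
case: w => [|[k|y] w] sz hv; first by exists [::].
  case: w sz hv => [|[j|y] w] //= sz => /andP[ky hv].
  case: (boolP (valid false w)) => hw.
    by apply: (IHcat [:: inl k; inr y] w); rewrite //= ky.
  case: w sz hv hw => [|b w] // sz hv hw.
  have [hyb hw'] := validF_behead hv hw.
  case: b hyb sz hv hw => [j|//] /= hyb sz hv hw.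
  by apply: (IHcat [:: inl k; inr y; inl j] w); rewrite //= ky hyb.
case: (boolP (valid false w)) => hw; first exact: (IHcat [:: inr y]).
case: w sz hv hw => [|b w] // sz /= hv hw.
have [hyb hw'] := validF_behead hv hw.
case: b hyb sz hv hw => [j|//] /= hyb sz hv hw.
by apply: (IHcat [:: inr y; inl j] w); rewrite //= hyb.
Qed.

Definition generators : seq (seq letter) :=
  [seq w <- [seq [:: a] | a : letter] ++ [seq [:: t.1; t.2] | t : letter * letter]
      ++ [seq [:: t.1; t.2.1; t.2.2] | t : letter * (letter * letter)]
      | valid false w].

Lemma mem_generators w :
  (w \in generators) = valid false w && (0 < size w <= 3)%N.
Proof.
rewrite mem_filter; congr (_ && _); rewrite !mem_cat.
apply/idP/idP.
  by case/or3P; case/mapP=> t _ ->.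
case: w => [|a [|b [|c [|d w]]]] //= _; apply/or3P.
- by constructor 1; apply/mapP; exists a; rewrite ?mem_enum.
- by constructor 2; apply/mapP; exists (a, b); rewrite ?mem_enum.
- by constructor 3; apply/mapP; exists (a, (b, c)); rewrite ?mem_enum.
Qed.

Definition bad_words : seq (seq letter) :=
  [seq [:: t.1; t.2.1; t.2.2] | t : letter * (letter * letter)
      in [pred t | ~~ supported t.1 t.2.1 t.2.2]].

Lemma avoiding_bad_words (x : int -> letter) :
  avoiding [set` bad_words] x <->
    forall i : int, supported (x (i - 1)) (x i) (x (i + 1)).
Proof.
have fE i : factor x (i - 1) 3 = [:: x (i - 1); x i; x (i + 1)].
  by rewrite !factorS subrK /factor.
split=> [h i|h i m /=].
  apply: contrapT => /negP bad; apply: (h (i - 1) 3%N) => /=.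
  by apply/mapP; exists (x (i - 1), (x i, x (i + 1))); rewrite ?mem_enum.
case/mapP=> -[a [b c]] /=; rewrite mem_enum /= => bad def.
have m3 : m = 3%N by rewrite -(size_factor x i m) def.
move: def; rewrite m3 -[i](addrK 1) fE => -[ha hb hc].
by move: bad; rewrite -ha -hb -hc inE /= h.
Qed.

Hypothesis pre_surj : forall k, exists y, pre y = Some k.
Hypothesis post_surj : forall k, exists y, post y = Some k.

(** A factor misses only the neighbours of its two end letters: [l] stands for the left one, and the
    appended [y] replaces the right one. *)
Lemma valid_rcons_factor (x : int -> letter) y :
  (forall i : int, supported (x (i - 1)) (x i) (x (i + 1))) ->
  forall m (i : int) (l : bool), (link (x (i - 1)) (x i) -> l) ->
  (~~ autonomous (x (i + m%:Z)) -> link (x (i + m%:Z)) (inr y)) ->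
  valid l (rcons (factor x i m.+1) (inr y)).
Proof.
move=> sx; elim=> [|m IH] i l hl hy.
  move: hy; rewrite /factor /= !addr0.
  by case: autonomous => //= ->; rewrite ?orbT.
have := IH (i + 1) (link (x i) (x (i + 1))).
rewrite (factorS x i) (factorS x (i + 1)) !rcons_cons valid_cons2 => ->.
- rewrite andbT; case/or3P: (sx i) => [->|/hl ->|->]; by rewrite ?orbT.
- by rewrite addrK.
- by rewrite -addrA -(intS m).
Qed.

Lemma renewal_generators :
  renewal generators = avoiding [set` bad_words].
Proof.
apply/seteqP; split=> x.
  move=> hx; apply/avoiding_bad_words => i.
  have /contrapT[s sL] := hx (i - 1) 3%N.
  have -> : factor x (i - 1) 3 = [:: x (i - 1); x i; x (i + 1)].
    by rewrite !factorS subrK /factor.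
  apply: valid_supported; apply: valid_flatten; apply/allP=> w /sL.
  by rewrite mem_generators => /andP[].
move/avoiding_bad_words => sx i [|m]; apply; first by exists [::].
(* The ends of a factor may be cut off from the letters they are linked to. Surjectivity of [pre]
   and [post] provides substitutes on both sides, and the padded word splits into generators. *)
have [y hy] : exists y, ~~ autonomous (x (i + m%:Z)) -> link (x (i + m%:Z)) (inr y).
  case: (x (i + m%:Z)) => [k|y]; last by exists y.
  by have [y hy] := pre_surj k; exists y => /=; rewrite hy.
have [z hz] : exists z, ~~ autonomous (x i) -> link (inr z) (x i).
  case: (x i) => [k|z]; last by exists z.
  by have [z hz] := post_surj k; exists z => /=; rewrite hz.
have [|s hs def] := @valid_parse (inr z :: rcons (factor x i m.+1) (inr y)).
  have v1 := @valid_rcons_factor x y sx m i true (fun _ => isT) hy.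
  move: v1; rewrite factorS rcons_cons valid_cons2 => v1.
  apply/andP; split=> //; move: v1 hz => /=.
  by case: (autonomous (x i)) => //= + ->.
exists s; first by move=> w /(allP hs); rewrite mem_generators.
rewrite -def; apply/infixP; exists [:: inr z], [:: inr y].
by rewrite /= cats1.
Qed.

End Words.

(** * Conjugacy with the edge shift of a finite automaton *)

Section Cover.
Variables (I Y : finType) (pre post : Y -> option I).

Notation letter := (I + Y)%type.

(* [inl o]: what has been read is complete, and a following letter [inl k]
   is linked iff [o = Some k]; [inr k]: an unlinked letter [inl k] has just been
   read, so the next letter must be linked to it. *)
Notation state := (option I + I)%type.

Definition step (s : state) (a : letter) : state :=
  match a with
  | inl k => if s == inl (Some k) then inl None else inr k
  | inr y => inl (post y)
  end.

Definition allowed (s : state) (a : letter) : bool :=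
  if s is inr k then link pre post (inl k) a else true.

Variables (n : nat) (enc : state -> 'I_n).
Hypothesis enc_inj : injective enc.

Definition transition := {p : state * letter | allowed p.1 p.2}.

Definition automaton : digraph n :=
  @Digraph n transition (fun e => enc (val e).1)
    (fun e => enc (step (val e).1 (val e).2)).

Lemma adjacency_automaton s t :
  adjacency automaton (enc s) (enc t)
  = (\sum_(a : letter) (allowed s a && (step s a == t))%N)%:Z.
Proof.
rewrite mxE; congr Posz.
rewrite -(card_image val_inj) -sum1_card.
transitivity (\sum_(p : state * letter | (p.1 == s) && (allowed s p.2 && (step s p.2 == t))) 1)%N.
  apply: eq_bigl => -[u a] /=. apply/mapP/idP.
    case=> -[[v b] /= hb]; rewrite mem_enum inE /= !(inj_eq enc_inj).
    by case/andP=> /eqP vs nt [-> ->]; rewrite -vs eqxx hb.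
  case/and3P=> /eqP /= -> ha hn; exists (Sub (s, a) ha) => //.
  by rewrite mem_enum inE /= !(inj_eq enc_inj) !eqxx.
rewrite -(pair_big (pred1 s) (fun a => allowed s a && (step s a == t)) (fun _ _ => 1%N)) /=.
by rewrite big_pred1_eq big_mkcond.
Qed.

Lemma step_eq_some s a k : (step s a == inl (Some k)) = link pre post a (inl k).
Proof. by case: a => [j|y] //=; case: ifP. Qed.

(** By [step_eq_some], the only information about a state that the next step uses depends on the
    last letter alone. So two letters determine the state, and the start [inl None] in [state_at] is
    arbitrary. *)
Lemma step_step s s' a b : step (step s a) b = step (step s' a) b.
Proof. by case: b => //= k; rewrite !step_eq_some. Qed.

Definition state_at (x : int -> letter) (i : int) : state :=
  step (step (inl None) (x (i - 2%:Z))) (x (i - 2%:Z + 1)).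

Lemma state_atS x i : step (state_at x i) (x i) = state_at x (i + 1).
Proof.
rewrite /state_at.
have -> : i + 1 - 2%:Z = i - 2%:Z + 1 by ring.
have -> : i - 2%:Z + 1 + 1 = i by ring.
exact: step_step.
Qed.

Definition read (x : int -> transition) (i : int) : letter := (val (x i)).2.

Lemma edge_shift_state (e : int -> transition) : edge_shift automaton e ->
  forall i : int, (val (e i)).1 = state_at (read e) i.
Proof.
move=> ge i.
have eS (j : int) : (val (e (j + 1))).1 = step (val (e j)).1 (read e j).
  by apply: enc_inj; exact: (esym (ge j)).
rewrite /state_at; have <- : i - 2%:Z + 1 + 1 = i by ring.
rewrite eS [(val (e (i - 2%:Z + 1))).1]eS.
have -> : i - 2%:Z + 1 + 1 - 2%:Z = i - 2%:Z by ring.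
exact: step_step.
Qed.

(** A letter [inl k] read without a link on its left leads to [inr k], where [allowed] demands the
    link on its right. *)
Lemma edge_shift_supported (e : int -> transition) : edge_shift automaton e ->
  forall i : int,
    supported pre post (read e (i - 1)) (read e i) (read e (i + 1)).
Proof.
move=> ge i; have := valP (e (i + 1)).
rewrite edge_shift_state // -state_atS -/(read e (i + 1)).
have -> : state_at (read e) i = step (state_at (read e) (i - 1)) (read e (i - 1)).
  by rewrite state_atS subrK.
rewrite /supported; case: (read e i) => [k|//]; rewrite [step _ (inl k)]/=.
by rewrite step_eq_some; case: (link _ _ _ (inl k)).
Qed.

(** Reading labels is a one-block code; its inverse recovers the state from the two preceding
    letters. *)
Lemma conjugate_automaton (a0 : letter) :
  conjugate (avoiding [set` bad_words pre post]) (edge_shift automaton).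
Proof.
(* A mere default: on points avoiding the bad words, the pair given to [insubd] is always
   allowed. *)
pose e0 : transition := Sub (inl None, a0) isT.
pose code w := insubd e0 (step (step (inl None) (nth a0 w 0)) (nth a0 w 1), nth a0 w 2).
pose f x i := code (factor x (i - 2%:Z) 3).
have fE x i : f x i = insubd e0 (state_at x i, x i).
  rewrite /f /code !factorS /= /state_at.
  by have -> : i - 2%:Z + 1 + 1 = i by ring.
have fV x : (forall i : int, supported pre post (x (i - 1)) (x i) (x (i + 1))) ->
    forall i, val (f x i) = (state_at x i, x i).
  move=> sx i; rewrite fE val_insubd ifT //= /allowed.
  have := state_atS x (i - 1); rewrite subrK => <-.
  move: (sx (i - 1)); rewrite subrK.
  case: (x (i - 1)) => [k|//] /=; case: ifP => //= /negbT.
  have -> : state_at x (i - 1) = step (state_at x (i - 1 - 1)) (x (i - 1 - 1)).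
    by rewrite state_atS subrK.
  by rewrite step_eq_some /supported => /negbTE ->.
exists f, read; split.
- split.
    move=> x /avoiding_bad_words sx i /=.
    by rewrite !fV //= state_atS.
  by exists 2%N, 0%N, code.
- split; last first.
    exists 0%N, 0%N, (fun w => (val (nth e0 w 0)).2) => e _ i.
    by rewrite factorS /= subr0.
  move=> e /edge_shift_supported; exact: (avoiding_bad_words pre post _).2.
- move=> x /avoiding_bad_words sx; apply/funext=> i.
  by rewrite /read fV.
- move=> e ge; apply/funext=> i; apply: val_inj.
  rewrite fV; last exact: edge_shift_supported.
  by rewrite -edge_shift_state // /read; case: (val (e i)).
Qed.

End Cover.

(** * Adjacency matrix for prescribed link counts *)

Section Realization.
Variables (r : nat) (C : 'M[int]_r).

(* The number of letters [y] with [pre y = ab.1] and [post y = ab.2]. The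
   value 2 is the one that decouples [Id + C] from the state [inl None] in the
   Bowen-Franks group. *)
Definition multiplicity (ab : option 'I_r * option 'I_r) : nat :=
  match ab with
  | (Some i, Some j) => `|C i j|
  | (None, None) => 3
  | _ => 2
  end.

Definition connector := {ab : option 'I_r * option 'I_r & 'I_(multiplicity ab)}.
Definition pre (y : connector) : option 'I_r := (tag y).1.
Definition post (y : connector) : option 'I_r := (tag y).2.

Lemma pre_surj k : exists y, pre y = Some k.
Proof. by exists (Tagged (fun ab => 'I_(multiplicity ab)) (i := (Some k, None)) ord0). Qed.

Lemma post_surj k : exists y, post y = Some k.
Proof. by exists (Tagged (fun ab => 'I_(multiplicity ab)) (i := (None, Some k)) ord0). Qed.

Lemma sum_connector (F : option 'I_r -> option 'I_r -> nat) :
  (\sum_(y : connector) F (pre y) (post y)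
   = \sum_a \sum_b multiplicity (a, b) * F a b)%N.
Proof.
rewrite pair_bigA /=.
transitivity (\sum_ab \sum_(j < multiplicity ab) F ab.1 ab.2)%N.
  by rewrite sig_big_dep.
by apply: eq_bigr => -[a b] _; rewrite sum_nat_const card_ord.
Qed.

Lemma sum_option (F : option 'I_r -> nat) :
  (\sum_o F o = F None + \sum_i F (Some i))%N.
Proof.
rewrite (bigD1 None) //=; congr (_ + _)%N.
rewrite (reindex_omap Some id) => [|[]] //=.
by apply: eq_bigl => i; rewrite eqxx.
Qed.

Definition enc (s : option 'I_r + 'I_r) : 'I_(1 + (r + r)) :=
  match s with
  | inl None => lshift _ ord0
  | inl (Some j) => rshift 1 (lshift r j)
  | inr j => rshift 1 (rshift r j)
  end.

Lemma enc_inj : injective enc.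
Proof.
have splitl p q (i : 'I_p) : split (lshift q i) = inl i := unsplitK (inl i).
have splitr p q (i : 'I_q) : split (rshift p i) = inr i := unsplitK (inr i).
pose dec (i : 'I_(1 + (r + r))) : option 'I_r + 'I_r :=
  if split i is inr k then
    if split k is inr j then inr j else if split k is inl j then inl (Some j)
    else inl None
  else inl None.
apply: (can_inj (g := dec)) => -[[i|]|i].
- by rewrite /dec /enc splitr splitl.
- by rewrite /dec /enc splitl.
- by rewrite /dec /enc !splitr.
Qed.

Local Notation e := (const_mx 1 : 'cV[int]_r).
(** For nonnegative [C], [t 0 j] is the number of letters [y] with [post y = Some j]. *)
Local Notation t := (e^T *m C + 2 *: e^T).

Hypothesis C_ge0 : forall i j, 0 <= C i j.

Lemma sum_nat_mul_eq (T : finType) (F : T -> nat) o :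
  (\sum_b F b * (b == o) = F o)%N.
Proof.
rewrite (bigD1 o) //= eqxx muln1 big1 ?addn0 // => b /negbTE ->.
by rewrite muln0.
Qed.

Lemma sum_post o : (\sum_y (post y == o) = \sum_a multiplicity (a, o))%N.
Proof.
rewrite (sum_connector (fun _ b => b == o)).
by apply: eq_bigr => a _; rewrite (sum_nat_mul_eq (fun b => multiplicity (a, b))).
Qed.

Lemma sum_pre_post o o' :
  (\sum_y (pre y == o) && (post y == o') = multiplicity (o, o'))%N.
Proof.
rewrite (sum_connector (fun a b => (a == o) && (b == o'))).
rewrite -(sum_nat_mul_eq (fun a => multiplicity (a, o'))); apply: eq_bigr => a _.
rewrite -(sum_nat_mul_eq (fun b => multiplicity (a, b))) big_distrl /=.
by apply: eq_bigr => b _; rewrite -mulnA mulnb andbC.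
Qed.

(** From [inl o] every [y] may be read, which gives [t] and [3 + 2 * r%:R]. Each [inl k] leads to
    [inr k], except from [inl (Some k)], where it leads to [inl None]: hence the [- 1%:M] and the 4.
    From [inr k] only the [y] with [pre y = Some k] are allowed. *)
Lemma adjacency_realization :
  adjacency (automaton pre post enc) =
  block_mx (3 + 2 * r%:R)%:M (row_mx t e^T)
    (col_mx ((4 + 2 * r%:R) *: e) (2 *: e))
    (block_mx (e *m t) (e *m e^T - 1%:M) C 0).
Proof.
have sum_t j : (\sum_a multiplicity (a, Some j))%:Z = t 0 j.
  rewrite sum_option PoszD addrC -[Posz (\sum_(i < r) _)%N]natz natr_sum !mxE; congr (_ + _).
  by apply: eq_bigr => i _; rewrite !mxE mul1r natz gez0_abs.
have sum_S : (\sum_a multiplicity (a, None))%:Z = 3 + 2 * r%:R.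
  by rewrite sum_option sum_nat_const card_ord PoszD PoszM mulrC (natz r).
apply/matrixP=> i j.
have [s ->] : exists s, i = enc s.
  case: (split_ordP i) => k ->; first by exists (inl None); rewrite (ord1 k).
  by case: (split_ordP k) => l ->; [exists (inl (Some l)) | exists (inr l)].
have [u ->] : exists s, j = enc s.
  case: (split_ordP j) => k ->; first by exists (inl None); rewrite (ord1 k).
  by case: (split_ordP k) => l ->; [exists (inl (Some l)) | exists (inr l)].
have et_entry k l : (e *m t) k l = t 0 l.
  by rewrite mxE big_ord1 mxE mul1r (ord1 0).
rewrite adjacency_automaton; last exact: enc_inj.
rewrite big_sumType /= PoszD.
have sumI (P : pred 'I_r) m : P =1 pred1 m -> (\sum_i P i = 1)%N.
  move=> Pm; rewrite -(sum_nat_mul_eq (fun=> 1%N) m).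
  by apply: eq_bigr => m' _; rewrite Pm mul1n.
case: s u => [[k|]|k] [[l|]|l]; rewrite /enc
  ?(block_mxEul, block_mxEur, block_mxEdl, block_mxEdr)
  ?(col_mxEu, col_mxEd) ?(row_mxEl, row_mxEr) /=.
- rewrite et_entry -sum_t -sum_post big1 // => m _.
  by case: ifP.
- rewrite !mxE mulr1 (sumI _ k) => [|m]; last first.
    by rewrite (inj_eq inl_inj) (inj_eq Some_inj) [k == m]eq_sym /=; case: ifP.
  by rewrite -[(\sum_(_ : connector) _)%N]/(\sum_y (post y == None))%N
    sum_post sum_S; lia.
- rewrite !mxE big_ord1 !mxE.
  have [<-{l}|kl] := eqVneq k l.
    rewrite subrr !big1 // => m _; rewrite (inj_eq inl_inj) (inj_eq Some_inj).
    by have [//|km] := eqVneq k m; rewrite (inj_eq inr_inj) eq_sym (negbTE km).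
  rewrite (sumI _ l) ?big1 // => m.
  rewrite (inj_eq inl_inj) (inj_eq Some_inj) /=.
  by have [<-|//] := eqVneq k m; rewrite (negbTE kl).
- by rewrite -sum_t -sum_post big1.
- by rewrite !mxE -sum_S -sum_post big1.
- by rewrite (sumI _ l) ?big1 ?mxE.
- rewrite big1 // add0r -[RHS]gez0_abs //.
  rewrite -[(absz _)%N]/(multiplicity (Some k, Some l)) -sum_pre_post.
  by congr Posz; apply: eq_bigr.
- rewrite big1 // add0r !mxE.
  rewrite -[2 * 1]/(multiplicity (Some k, None))%:Z -sum_pre_post.
  by congr Posz; apply: eq_bigr.
- by rewrite !big1 ?mxE // => y _; rewrite andbF.
Qed.
End Realization.

(** * Unimodular reduction of [Id - A] *)

Section Reduction.
Variables (r : nat) (C : 'M[int]_r).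

Local Notation e := (const_mx 1 : 'cV[int]_r).
Local Notation t := (e^T *m C + 2 *: e^T).

Definition transition_mx : 'M[int]_(1 + (r + r)) :=
  block_mx (3 + 2 * r%:R)%:M (row_mx t e^T)
    (col_mx ((4 + 2 * r%:R) *: e) (2 *: e))
    (block_mx (e *m t) (e *m e^T - 1%:M) C 0).

(* Change of generators of the Bowen-Franks group: with [S], [T_j], [P_j] the
   classes of the states [inl None], [inl (Some j)], [inr j], it exhibits
   [P_j - 2 S] and [T_j + (P_j - 2 S)]. *)
Definition reduce_mx : 'M[int]_(1 + (r + r)) :=
  block_mx 1%:M 0 (col_mx 0 (2 *: e)) (block_mx 1%:M (- 1%:M) 0 1%:M).

(** The states [inl (Some j)] and [inl None] differ only in the effect of the letter [inl j];
    subtracting their rows leaves the relation [T_j + P_j - 2 S = 0]. *)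
Let rowop : 'M[int]_(1 + (r + r)) := block_mx 1%:M 0 (col_mx (- e) 0) 1%:M.

Let unitri : 'M[int]_(1 + (r + r)) :=
  block_mx 1%:M (row_mx (- t) e^T) 0 (block_mx 1%:M 0 (- C) 1%:M).

Let reduced : 'M[int]_(1 + (r + r)) :=
  block_mx (- (4 * r + 2)%:R)%:M 0 0 (block_mx 1%:M 0 0 (1%:M + C)).

(** Put [Q_j = P_j - 2 S]. The rows of [inl (Some j)] give [T_j = - Q_j], so those of [inr j] become
    [(1 + C) Q = 0]. The row of [inl None] becomes [- (4 r + 2) S + (t - e^T) Q], and
    [t - e^T = e^T (1 + C)] makes its last term redundant. *)
Lemma reductionE :
  rowop *m (1%:M - transition_mx) *m reduce_mx = unitri *m reduced.
Proof.
have ee : e^T *m e = r%:R%:M.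
  apply/matrixP=> i j; rewrite !mxE (ord1 i) (ord1 j) eqxx.
  by under eq_bigr do rewrite !mxE mul1r; rewrite sumr_const card_ord.
have step1 : rowop *m (1%:M - transition_mx) =
    block_mx (- (2 + 2 * r%:R))%:M (row_mx (- t) (- e^T))
      (col_mx (- (2 *: e)) (- (2 *: e))) (block_mx 1%:M 1%:M (- C) 1%:M).
  rewrite /rowop /transition_mx.
  rewrite [1%:M in X in _ *m X]scalar_mx_block.
  rewrite [1%:M in X in block_mx _ _ _ X - _]scalar_mx_block.
  rewrite opp_block_mx add_block_mx opp_block_mx add_block_mx opp_col_mx
    opp_row_mx !add0r mulmx_block !mul1mx !mul0mx !addr0 mul_col_row
    mul_col_mx !mul0mx add_col_mx add_block_mx !add0r.
  congr block_mx.
  - by rewrite -raddfB; congr _%:M; ring.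
  - congr col_mx; apply/matrixP=> i j.
    by rewrite !mxE big_ord1 !mxE (ord1 j) eqxx !mulr1n; lia.
  - by rewrite mulNmx mulmxN opprK addrC subrK mulNmx mulmxN opprK opprB addrC subrK subr0.
have step2 : unitri *m reduced =
    block_mx (- (2 + 4 * r%:R))%:M (row_mx (- t) (t - e^T)) 0
      (block_mx 1%:M 0 (- C) (1%:M + C)).
  rewrite /unitri /reduced mulmx_block mul_row_block mulmx_block.
  rewrite !(mul1mx, mul0mx, mulmx0, mulmx1, addr0, add0r).
  congr block_mx.
  - by congr _%:M; rewrite natrD natrM; ring.
  - by congr row_mx; rewrite mulmxDr mulmx1 scaler_nat mulr2n addrA addrK addrC.
rewrite step1 step2 /reduce_mx mulmx_block mul_row_col mul_row_block mul_col_mx.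
rewrite mul_block_col mulmx_block.
rewrite !(mul1mx, mul0mx, mulmx0, mulmx1, addr0, add0r, mulmxN, mulNmx, opprK).
congr block_mx.
- rewrite -scalemxAr ee scale_scalar_mx -raddfB.
  by congr _%:M; ring.
- by rewrite add_col_mx !addNr col_mx0.
- by rewrite addNr (addrC C).
Qed.

Let det_unitri : \det unitri = 1.
Proof. by rewrite /unitri det_ublock det_lblock !det1 !mul1r. Qed.

Lemma det_reduce_mx : \det reduce_mx = 1.
Proof. by rewrite det_lblock det_ublock !det1 !mul1r. Qed.

Let det_rowop : \det rowop = 1.
Proof. by rewrite det_lblock !det1 mul1r. Qed.

Lemma det_transition_mx :
  \det (1%:M - transition_mx) = - (4 * r + 2)%:R * \det (1%:M + C).
Proof.
have := congr1 determinant reductionE.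
rewrite !det_mulmx det_rowop det_unitri det_reduce_mx mul1r mulr1 mul1r => ->.
by rewrite det_ublock det_ublock det_scalar1 det1 mul1r.
Qed.

Lemma reduced_span (w : 'rV[int]_(1 + (r + r))) :
  (exists v, w = v *m reduced) <->
  ((4 * r + 2)%:Z %| w ord0 (lshift _ ord0))%Z
  /\ exists q, rsubmx (rsubmx w) = q *m (1%:M + C).
Proof.
rewrite /reduced; split=> [[v ->]|[/dvdzP[a wa] [q wq]]].
  rewrite -[v]hsubmxK -[rsubmx v]hsubmxK !mul_row_block !mulmx0 !addr0 !add0r.
  rewrite row_mxEl mul_mx_scalar mxE row_mxKr row_mxKr; split; last by eexists.
  by apply: dvdz_mulr; rewrite natz dvdzE abszN.
exists (row_mx (- a)%:M (row_mx (lsubmx (rsubmx w)) q)).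
rewrite !mul_row_block !mulmx0 !addr0 !add0r -wq mulmx1 -[LHS]hsubmxK.
congr row_mx; last by rewrite -[LHS]hsubmxK.
apply/rowP=> i; rewrite (ord1 i) mul_mx_scalar !mxE wa.
by rewrite mulr1n natz; ring.
Qed.

(** The left factors in [reductionE] are unimodular and preserve the row lattice, while [reduce_mx]
    changes coordinates; membership is thus read off [reduced]. *)
Lemma transition_span (u : 'rV[int]_(1 + (r + r))) :
  (exists v, u = v *m (1%:M - transition_mx)) <->
  ((4 * r + 2)%:Z %| (u *m reduce_mx)%R ord0 (lshift _ ord0))%Z
  /\ exists q, rsubmx (rsubmx (u *m reduce_mx)) = q *m (1%:M + C).
Proof.
have uW : reduce_mx \in unitmx by rewrite unitmxE det_reduce_mx unitr1.
have uE : rowop \in unitmx by rewrite unitmxE det_rowop unitr1.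
have uU : unitri \in unitmx by rewrite unitmxE det_unitri unitr1.
rewrite -reduced_span; split=> -[v def_u].
  exists (v *m invmx rowop *m unitri).
  by rewrite -mulmxA -reductionE def_u !mulmxA mulmxKV.
exists (v *m invmx unitri *m rowop); apply: (can_inj (mulmxK uW)).
by rewrite def_u -!mulmxA (mulmxA rowop) reductionE !mulmxA mulmxKV.
Qed.

End Reduction.

(** * Identification of the quotient group and choice of [C] *)

Lemma zmod_iso_BF n (A : 'M[int]_n) (H : zmodType) (f : 'rV[int]_n -> H) :
  (forall u v, f (u - v) = f u - f v) -> (forall h, exists u, f u = h) ->
  (forall u, f u = 0 <-> exists v, u = v *m (1%:M - A)) ->
  zmod_iso (BF A) H.
Proof.
move=> fB fsurj fker.
have f_pi u : f (repr (\pi_(BF A) u)%qT) = f u.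
  apply/eqP; rewrite -subr_eq0 -fB; apply/eqP/fker/asboolP.
  have := Quotient.idealrBE (GRing.ZmodClosed.clone _ (BF_rel A) _)
    (repr (\pi_(BF A) u)%qT) u.
  by rewrite reprK eqxx.
pose g (x : BF A) := f (repr x).
have gB : zmod_morphism g.
  move=> x y; rewrite /g -fB -[in LHS](reprK x) -[in LHS](reprK y).
  by rewrite -[X in repr X](raddfB (\pi_(BF A))%qT) f_pi.
pose ga : {additive BF A -> H} := HB.pack g (GRing.isZmodMorphism.Build _ _ g gB).
exists ga; have [inv invK] := choice fsurj.
exists (fun h => \pi_(BF A) (inv h))%qT => x.
  rewrite -[RHS]reprK; apply/eqP.
  rewrite -Quotient.idealrBE; apply/asboolP/fker.
  by rewrite fB invK subrr.
by rewrite /= /g f_pi.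
Qed.

Lemma intr_Zp_eq0 m (z : int) : (1 < m)%N -> ((z%:~R : 'Z_m) == 0) = (m %| z)%Z.
Proof.
move=> m_gt1; have nat0 (k : nat) : ((k%:R : 'Z_m) == 0) = (m %| k)%N.
  by rewrite -(inj_eq val_inj) /= val_Zp_nat.
case: z => k; first exact: nat0.
by rewrite NegzE mulrNz oppr_eq0 dvdzE abszN; apply: nat0.
Qed.

(** [foldl] absorbs the first cyclic factor into [G], so the induction generalizes over [G]. With
    coordinates indexed by [nat], passing to the tail is a shift. *)
Lemma plus_cyclics_presentation (G : zmodType) (n : seq nat) :
  (forall m, m \in n -> (2 <= m)%N) ->
  exists F : G -> (nat -> int) -> plus_cyclics G n,
  [/\ forall g g' z z', F (g - g') (fun i => z i - z' i) = F g z - F g' z',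
      forall h, exists g z, F g z = h &
      forall g z, F g z = 0 <->
        g = 0 /\ forall i, (i < size n)%N -> (nth 0%N n i %| z i)%Z].
Proof.
elim: n G => [|m n IH] G n_ge2.
  exists (fun g _ => g); split=> // [h|g z]; first by exists h, (fun=> 0).
  by split=> [|[]].
have m_ge2 : (1 < m)%N by apply: n_ge2; rewrite mem_head.
have [|F [FB Fsurj Fker]] := IH (G * 'Z_m)%type.
  by move=> p np; apply: n_ge2; rewrite inE np orbT.
exists (fun g z => F (g, (z 0%N)%:~R) (fun i => z i.+1)); split.
- by move=> g g' z z'; rewrite -FB rmorphB.
- move=> h; have [[g x] [z <-]] := Fsurj h.
  exists g, (fun i => if i is j.+1 then z j else (x : nat)%:Z).
  by rewrite -pmulrn natr_Zp.
- move=> g z; split=> [/Fker[/pair_equal_spec[-> /eqP z0] zS]|[-> z_dvd]].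
    split=> // -[_|i]; last exact: zS.
    by rewrite -intr_Zp_eq0.
  apply/Fker; split=> [|i ilt]; last exact: (z_dvd i.+1).
  by congr pair; apply/eqP; rewrite intr_Zp_eq0 // (z_dvd 0%N).
Qed.

(** The coordinates facing the invertible block [B] can always be solved for; the others are solved
    by division. *)
Lemma diag_span s (B : 'M[int]_s) k (d : 'rV[int]_k) (x : 'rV[int]_(s + k)) :
  B \in unitmx ->
  (exists q, x = q *m block_mx B 0 0 (diag_mx d)) <->
  forall i, (d ord0 i %| x ord0 (rshift s i))%Z.
Proof.
move=> uB; split=> [[q ->] i|dx].
  rewrite -[q]hsubmxK mul_row_block !mulmx0 add0r row_mxEr mul_mx_diag mxE.
  exact: dvdz_mull.
exists (row_mx (lsubmx x *m invmx B) (\row_i (x ord0 (rshift s i) %/ d ord0 i)%Z)).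
rewrite mul_row_block !mulmx0 addr0 add0r mulmxKV // -[LHS]hsubmxK.
by congr row_mx; apply/rowP=> i; rewrite mul_mx_diag !mxE divzK.
Qed.

(** Take [1 + C] to be [B] followed by the diagonal of the [n_i]; [B_ge1] makes [C] nonnegative. The
    determinant is [- (4 r + 2) * det B] times the product of the [n_i], and the class [S] generates
    the factor of order [4 r + 2]. *)
Lemma signed_BF_realization s (B : 'M[int]_s) (n : seq nat) :
  (forall m, m \in n -> (2 <= m)%N) ->
  (forall i j, (1%:M : 'M[int]_s) i j <= B i j) -> B \in unitmx ->
  exists (A : finType) (L : seq (seq A)),
    [/\ L != [::] /\ [::] \notin L, finite_type (renewal L) &
        signed_BF (renewal L) (- Num.sg (\det B))
          (plus_cyclics 'Z_(4 * (s + size n) + 2) n)].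
Proof.
move=> n_ge2 B_ge1 uB; pose r := (s + size n)%N; pose c := (4 * r + 2)%N.
pose d : 'rV[int]_(size n) := \row_i (nth 0%N n i)%:Z.
have dE i : d ord0 i = (nth 0%N n i)%:Z by rewrite mxE.
have d_gt0 i : 0 < d 0 i.
  by rewrite mxE ltz_nat (leq_trans _ (n_ge2 _ (mem_nth 0%N (ltn_ord i)))).
pose BD := block_mx B 0 0 (diag_mx d); pose C := BD - 1%:M.
have CE : 1%:M + C = BD by rewrite addrC subrK.
have C_ge0 i j : 0 <= C i j.
  rewrite /C /BD (scalar_mx_block s (size n)) opp_block_mx add_block_mx.
  case: (split_ordP i) => i' ->; case: (split_ordP j) => j' ->;
    rewrite ?(block_mxEul, block_mxEur, block_mxEdl, block_mxEdr) !mxE ?subrr //.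
    by have := B_ge1 i' j'; rewrite mxE subr_ge0.
  by have := d_gt0 i'; rewrite mxE; case: eqP => //=; lia.
(* For a modulus below 2, ['Z_c] would not be the integers modulo [c]. *)
have c_gt1 : (1 < c)%N by rewrite /c; lia.
exists ('I_r + connector C)%type, (generators (@pre r C) (@post r C)).
have renE := renewal_generators (@pre_surj r C) (@post_surj r C).
pose y0 : connector C := Tagged (fun ab => 'I_(multiplicity C ab)) (i := (None, None)) ord0.
split.
- split; last by rewrite mem_generators.
  have : [:: inr y0] \in generators (@pre r C) (@post r C) by rewrite mem_generators.
  by case: generators.
- by exists (bad_words (@pre r C) (@post r C)).
exists (1 + (r + r))%N, (automaton (@pre r C) (@post r C) (@enc r)).
have adjE : adjacency (automaton (@pre r C) (@post r C) (@enc r)) = transition_mx C.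
  exact: adjacency_realization.
rewrite adjE; split.
- rewrite renE; exact: (conjugate_automaton _ _ (@enc_inj r) (inr y0)).
- have [F [FB Fsurj Fker]] := plus_cyclics_presentation 'Z_c n_ge2.
  (* The coordinates beyond [size n] get the default 0; [Fker] tests only the others. *)
  pose W := reduce_mx r; pose z (w : 'rV[int]_(1 + (r + r))) i : int :=
    oapp (fun j => rsubmx (rsubmx w) 0 (rshift s j)) 0 (insub i).
  pose f (u : 'rV[int]_(1 + (r + r))) :=
    F ((u *m W) ord0 (lshift _ ord0))%:~R (z (u *m W)).
  apply: (@zmod_iso_BF _ _ _ f).
  + move=> u v; rewrite /f -FB mulmxBl; congr F; first by rewrite !mxE rmorphB.
    by apply/funext=> i; rewrite /z; case: insubP => [j _ _|] /=; rewrite ?subrr ?mxE.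
  + move=> h; have [g [y <-]] := Fsurj h.
    pose w : 'rV[int]_(1 + (r + r)) := row_mx (g : nat)%:Z%:M
      (row_mx 0 (row_mx 0 (\row_(i < size n) y i))).
    have uW : W \in unitmx by rewrite unitmxE det_reduce_mx unitr1.
    exists (w *m invmx W); rewrite /f mulmxKV //.
    apply/eqP; rewrite -subr_eq0 -FB; apply/eqP/Fker; split=> [|i ilt].
      by rewrite row_mxEl mxE eqxx mulr1n -pmulrn natr_Zp subrr.
    by rewrite /z insubT /= !row_mxKr row_mxEr mxE subrr dvdz0.
  + move=> u; rewrite /f Fker transition_span CE.
    rewrite diag_span //.
    have zE := intr_Zp_eq0 ((u *m W) ord0 (lshift (r + r) ord0)) c_gt1.
    split=> -[a0 zd]; split=> [|i].
    * by rewrite -zE; apply/eqP.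
    * by rewrite dE; have := zd i (ltn_ord i); rewrite /z valK.
    * by apply/eqP; rewrite zE.
    * by move=> ilt; have := zd (Ordinal ilt); rewrite dE /z insubT.
- rewrite det_transition_mx CE det_ublock det_diag !sgrM sgrN gtr0_sg ?mulN1r.
    rewrite (gtr0_sg (x := \prod_i _)) ?mulr1 //.
    by apply: prodr_gt0.
  by rewrite ltr0n; lia.
Qed.

Theorem theorem5p57 (n : seq nat)
    (n_ge2 : forall m, m \in n -> (2 <= m)%N)
    (n_dvd : forall i, (0 < i < size n)%N -> (nth 0%N n i %| nth 0%N n i.-1)%N) :
  exists Gp Gm : zmodType,
    [/\ at_most_two_generators Gp, at_most_two_generators Gm &
    exists (Ap Am : finType) (Lp : seq (seq Ap)) (Lm : seq (seq Am)),
      [/\ Lp != [::] /\ [::] \notin Lp, Lm != [::] /\ [::] \notin Lm,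
          finite_type (renewal Lp), finite_type (renewal Lm) &
          signed_BF (renewal Lp) 1 (plus_cyclics Gp n) /\
          signed_BF (renewal Lm) (-1) (plus_cyclics Gm n)]].
Proof.
have gen2 m : at_most_two_generators 'Z_m.
  exists 1, 0 => x; exists (x : nat)%:Z, 0.
  by rewrite mulr0z addr0 -pmulrn natr_Zp.
(* Determinant -1 with nonnegative [B - Id]: flips the sign and adds nothing to
   the group. *)
pose B : 'M[int]_2 := \matrix_(i, j) if (j < i)%N then 2 else 1.
have detB : \det B = -1 
  by rewrite (expand_det_row _ ord0) big_ord_recl big_ord1 /cofactor !det_mx11 !mxE.
have [||Ap [Lp [Lp1 Lp2 Lp3]]] := @signed_BF_realization _ B n n_ge2.
- by move=> i j; rewrite !mxE; case: ifP; case: eqP.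
- by rewrite unitmxE detB.
(* The empty block has determinant 1, so the minus sign of [det_transition_mx] survives. *)
have [||Am [Lm [Lm1 Lm2 Lm3]]] := @signed_BF_realization 0 1%:M n n_ge2.
- by case.
- exact: unitmx1.
exists 'Z_(4 * (2 + size n) + 2), 'Z_(4 * (0 + size n) + 2); split=> //.
exists Ap, Am, Lp, Lm; split=> //; split.
  by move: Lp3; rewrite detB.
by move: Lm3; rewrite det1.
Qed.
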